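(* Let $X$ be a metric space, $\Phi^t$ a flow on $X$ preserving a measure $\mu$, and $\Sigma$ a section of $(X,\Phi^t)$. Suppose that the flow $\Phi^t$ is ergodic and that the section $\Sigma$ has induced map $F$ and invariant measure $\mu_F$ such that $\int_\Sigma t(x)\,d\mu_F<\infty$. For $r\ge 0$ let $S_r\subseteq\Sigma$ be a decreasing family of measurable subsets with $\lim_{r\to 0}\mu_F(S_r)=0$. Consider the hitting time relative to the Poincaré map $$\tau^\Sigma(x,S_r)=\min\{n\in\mathbb{N}^+ : F^n(x)\in S_r\}.$$ Then there is a full measure set $C\subseteq X$ such that if $x\in C$ then $$\lim_{r\to 0}\frac{\log\tau(x,S_r)}{-\log r}=\lim_{r\to 0}\frac{\log\tau^\Sigma(\pi(x),S_r)}{-\log r}$$ (in the sense that if one of the two limits exists, so does the other, and they are equal).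
   Context: For $x\in X$, $t(x)$ denotes the smallest strictly positive time such that $\Phi^{t(x)}(x)\in\Sigma$, and $t'(x)$ denotes the smallest nonnegative time such that $\Phi^{t'(x)}(x)\in\Sigma$ (so on $\Sigma$, $t'=0$ while $t$ is the return time to $\Sigma$). The projection $\pi:X\to\Sigma$ is $\pi(x)=\Phi^{t'(x)}(x)$. The induced (Poincaré first return) map is $F:\Sigma\to\Sigma$, $F(x)=\Phi^{t(x)}(x)$, and $\mu_F$ is the $F$-invariant (probability) measure on $\Sigma$ induced by the flow-invariant measure $\mu$. Hitting time of the flow: $\tau(x,A)=\inf\{t\in\mathbb{R}^+ : \Phi^t(x)\in A\}$. The family $S_r$ is decreasing as $r\to 0$: $S_r\subseteq S_{r'}$ for $r\le r'$, and $S_0=\bigcap_{r>0}S_r$. *)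

(* Defs.v *)
From HB Require Import structures.
From mathcomp Require Import all_boot all_order all_algebra.
From mathcomp Require Import all_classical all_reals all_analysis measurable_realfun.
Set Implicit Arguments.
Unset Strict Implicit.
Unset Printing Implicit Defensive.
Import Order.TTheory GRing.Theory Num.Theory.
Import numFieldNormedType.Exports.
Local Open Scope classical_set_scope.
Local Open Scope ring_scope.

(* A metricType need not be pointed, whereas a measurableType is. *)
#[short(type="pointedMetricType")]
HB.structure Definition PointedMetric (K : numDomainType) :=
  {T of Metric K T & Pointed T}.

Notation borel X := (g_sigma_algebraType (@open X)).

Section Flow.
Context {R : realType} {X : pointedMetricType R}.
Variable Phi : R -> X -> X.

(* Joint Borel measurability is implied by joint continuity. *)
Definition is_flow : Prop :=
  [/\ forall x, Phi 0 x = x,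
      forall s t x, Phi (s + t) x = Phi s (Phi t x)
    & measurable_fun [set: (measurableTypeR R * borel X)%type]
        ((fun z => Phi z.1 z.2) : measurableTypeR R * borel X -> borel X)].

Definition flow_preserves (mu : {measure set (borel X) -> \bar R}) : Prop :=
  forall (t : R) (A : set (borel X)), measurable A ->
    mu (Phi t @^-1` A) = mu A.

Definition flow_ergodic (mu : {measure set (borel X) -> \bar R}) : Prop :=
  forall A : set (borel X), measurable A ->
    (forall t, Phi t @^-1` A = A) -> mu A = 0%E \/ mu (~` A) = 0%E.

(* [hitting_time A x] is tau(x, A); it is +oo when x never enters A. *)
Definition hitting_time (A : set X) (x : X) : \bar R :=
  ereal_inf [set t%:E | t in [set t : R | 0 < t /\ A (Phi t x)]].

(* As [hitting_time], but time 0 is allowed. *)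
Definition entry_time (A : set X) (x : X) : \bar R :=
  ereal_inf [set t%:E | t in [set t : R | 0 <= t /\ A (Phi t x)]].

Variable Sigma : set X.

(* t(x) and t'(x). *)
Definition return_time (x : X) : \bar R := hitting_time Sigma x.
Definition projection_time (x : X) : \bar R := entry_time Sigma x.

(* The infimum defining t(x) is a minimum: a smallest positive time at which
   the orbit of x is in Sigma exists. *)
Definition returns (x : X) : Prop :=
  exists2 t : R, 0 < t /\ Sigma (Phi t x) & return_time x = t%:E.

(* Where the infinite value is taken (a null set for a section), [fine]
   replaces it by 0 and the two maps below fix the point. *)
Definition poincare_map (x : X) : X := Phi (fine (return_time x)) x.
Definition section_proj (x : X) : X := Phi (fine (projection_time x)) x.

Definition is_section (mu : {measure set (borel X) -> \bar R}) : Prop :=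
  [/\ measurable (Sigma : set (borel X)),
      measurable_fun [set: borel X] (return_time : borel X -> \bar R)
    & {ae mu, forall x : borel X, returns x}].

(* muF, as a measure on X carried by Sigma, is the invariant probability of the
   Poincare map induced by mu: mu is proportional to the measure obtained by
   flowing muF along the orbits until the next return to Sigma
   (Ambrose-Kakutani). If mu is a probability, c is 1 / \int t dmuF. *)
Definition is_induced_measure (mu : {measure set (borel X) -> \bar R})
    (muF : probability (borel X) R) : Prop :=
  [/\ muF (~` Sigma) = 0%E,
      {ae muF, forall x : borel X, returns x},
      forall A : set (borel X), measurable A ->
        muF (poincare_map @^-1` A) = muF A
    & exists2 c : R, 0 < c & forall A : set (borel X), measurable A ->
        mu A = (c%:E *
          \int[muF]_(y in Sigma)
            \int[lebesgue_measure]_(s in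
                [set s : R | (0 <= s)%R /\ s%:E < return_time y])
              (\1_A (Phi s y))%:E)%E].

(* tau^Sigma(x, A), equal to +oo when the forward F-orbit of x avoids A. *)
Definition poincare_hitting_time (x : X) (A : set X) : \bar R :=
  ereal_inf [set n%:R%:E | n in
    [set n : nat | (0 < n)%N /\ A (iter n poincare_map x)]].

End Flow.

(* Main.v *)
(** If y = pi(x) = Phi^s(x) and t_n(y) denotes the n-th visit time of y to
    Sigma, then tau(x, S_r) = s + t_n(y) for n = tau^Sigma(y, S_r), provided
    y is not in S_r, which holds for small r because S_0 is muF-null.  It
    therefore suffices that a n <= t_n(y) <= b n for some a, b > 0 depending
    on y: the two logarithms then differ by a bounded amount, which is
    negligible against - log r.  Both bounds hold muF-almost everywhere by the
    maximal ergodic inequality, applied to the return time for the upper one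
    and to the indicators of {t < 1/m} for the lower one. *)
Require Import Defs.
From mathcomp Require Import all_boot all_order all_algebra.
From mathcomp Require Import all_classical all_reals all_analysis measurable_realfun.
Set Implicit Arguments.
Unset Strict Implicit.
Unset Printing Implicit Defensive.
Import Order.TTheory GRing.Theory Num.Theory.
Import numFieldNormedType.Exports HBNNSimple.
Local Open Scope classical_set_scope.
Local Open Scope ring_scope.

(* Scan from the left: step over an index where [b] vanishes, and jump over a
   block where [a] has average at least [lam]; the last block may overrun [M]
   by at most [N]. *)
Lemma greedy_covering (R : realType) (a b : nat -> \bar R) (lam : R) (N : nat) :
  0 <= lam -> (forall i, 0 <= a i)%E ->
  (forall k, (b k <= lam%:E)%E /\ (b k = 0%E \/
     exists n, [/\ (0 < n)%N, (n <= N)%N &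
       ((n%:R * lam)%:E <= \sum_(i < n) a (k + i)%N)%E])) ->
  forall M k, (\sum_(i < M) b (k + i)%N <= \sum_(i < M + N) a (k + i)%N)%E.
Proof.
move=> lam0 a0 H M; have [m] := ubnP M; elim: m M => // m IH M Mm k.
have suma0 n j : (0 <= \sum_(i < n) a (j + i)%N)%E by exact: sume_ge0.
have split (c : nat -> \bar R) n n' j : (\sum_(i < n + n') c (j + i)%N =
   \sum_(i < n) c (j + i)%N + \sum_(i < n') c (j + n + i)%N)%E.
  by rewrite big_split_ord /=; congr (_ + _)%E; apply: eq_bigr => i _; rewrite addnA.
have blam n : (\sum_(i < n) b (k + i)%N <= (n%:R * lam)%:E)%E.
  rewrite mulr_natl -[X in _ *+ X]card_ord -sumr_const -sumEFin.
  by apply: lee_sum => i _; have [] := H (k + i)%N.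
case: M Mm => [_|M Mm]; first by rewrite big_ord0.
have [_ [bk0|[n [n0 nN nlam]]]] := H k.
  rewrite big_ord_recl addSn [leRHS]big_ord_recl /= addn0 bk0.
  apply: leeD => //.
  have shift (c : nat -> \bar R) n : (\sum_(i < n) c (k + bump 0 i)%N)%R =
      (\sum_(i < n) c (k.+1 + i)%N)%R.
    by apply: eq_bigr => i _; rewrite addSnnS.
  by rewrite !shift; exact: IH.
have [nM|Mn] := leqP n M.+1.
  rewrite -(subnKC nM) -addnA (split b) (split a).
  apply: leeD; first exact: le_trans (blam n) nlam.
  by apply: IH; move: Mm; rewrite ltnS; apply: leq_trans; rewrite ltn_subrL n0.
(* The block overruns the range: since [n > M.+1], all remaining values of [b] sum to at most
   [n * lam], which the block pays for, and [n <= N] keeps the block inside [M.+1 + N] terms. *)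
apply: (le_trans (blam _)).
have -> : (M.+1 + N = n + (M.+1 + N - n))%N.
  by rewrite subnKC// (leq_trans nN)// leq_addl.
rewrite split; apply: le_trans (leeDl _ (suma0 _ _)).
apply: le_trans nlam.
by rewrite lee_fin ler_wpM2r// ler_nat ltnW.
Qed.

(** * Maximal ergodic inequality and two null sets derived from it *)

Section MaximalInequality.
Context d (T : measurableType d) (R : realType) (P : probability T R).
Variable F : T -> T.
Hypothesis mF : measurable_fun [set: T] F.
Hypothesis PF : forall A, measurable A -> P (F @^-1` A) = P A.

Definition birkhoff_sum (f : T -> \bar R) (n : nat) (x : T) : \bar R :=
  (\sum_(i < n) f (iter i F x))%E.

Lemma measurable_iter k : measurable_fun [set: T] (iter k F).
Proof. by elim: k => [|k IH]; [exact: measurable_id | exact: measurableT_comp]. Qed.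

Lemma iter_preserves k A : measurable A -> P (iter k F @^-1` A) = P A.
Proof.
elim: k A => // k IH A mA.
have mFA : measurable (F @^-1` A) by rewrite -[X in measurable X]setTI; exact: mF.
by rewrite -(PF mA) -(IH _ mFA).
Qed.

Variable f : T -> \bar R.
Hypothesis mf : measurable_fun [set: T] f.
Hypothesis f0 : forall x, (0 <= f x)%E.

Lemma integral_comp_iter k : (\int[P]_x f (iter k F x) = \int[P]_x f x)%E.
Proof.
have := @ge0_integral_pushforward _ _ _ _ R _ (measurable_iter k) P setT f
  measurableT mf (fun y _ => f0 y).
rewrite preimage_setT => <-.
apply: eq_measure_integral; first exact: measurable_iter.
by move=> mk A mA _; exact: (iter_preserves k mA).
Qed.

Lemma measurable_birkhoff_sum n : measurable_fun [set: T] (birkhoff_sum f n).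
Proof.
by apply: emeasurable_sum => i; apply: measurableT_comp => //; exact: measurable_iter.
Qed.

Lemma integral_birkhoff_sum n :
  (\int[P]_x birkhoff_sum f n x = n%:R%:E * \int[P]_x f x)%E.
Proof.
rewrite ge0_integral_sum//; last first.
  by move=> i; apply: measurableT_comp => //; exact: measurable_iter.
under eq_bigr do rewrite integral_comp_iter.
elim: n => [|n IH]; first by rewrite big_ord0 mul0e.
by rewrite big_ord_recr /= IH -[in RHS]addn1 natrD EFinD ge0_muleDl// mul1e.
Qed.

Lemma measurable_birkhoff_ge n (c : \bar R) :
  measurable [set x | (c <= birkhoff_sum f n x)%E].
Proof.
rewrite -[X in measurable X]setTI.
exact: emeasurable_fun_c_infty (measurable_birkhoff_sum n) _.
Qed.

Definition birkhoff_exceeds (lam : R) : set T :=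
  \bigcup_(n in [set n | (0 < n)%N]) [set x | ((n%:R * lam)%:E <= birkhoff_sum f n x)%E].

Lemma measurable_birkhoff_exceeds lam : measurable (birkhoff_exceeds lam).
Proof. by apply: bigcup_measurable => n _; exact: measurable_birkhoff_ge. Qed.

(** Limiting the block length to [N] bounds the overrun of the covering, so its cost per unit of
    time vanishes as the orbit gets longer; continuity of the measure from below then removes
    [N]. *)
Lemma maximal_inequality (lam : R) : 0 <= lam ->
  (lam%:E * P (birkhoff_exceeds lam) <= \int[P]_x f x)%E.
Proof.
move=> lam0.
pose E N := \bigcup_(n in [set n | (0 < n <= N)%N])
  [set x | ((n%:R * lam)%:E <= birkhoff_sum f n x)%E].
have mE N : measurable (E N).
  by apply: bigcup_measurable => n _; exact: measurable_birkhoff_ge.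
have EU : birkhoff_exceeds lam = \bigcup_N E N.
  apply/seteqP; split => x.
    by move=> [n n0 xn]; exists n => //; exists n => //=; rewrite leqnn andbT.
  by move=> [N _ [n /andP[n0 _] xn]]; exists n.
have EE x N : (\1_(E N) x : R) = if x \in E N then 1 else 0 by rewrite indicE; case: ifP.
(* Integrate [greedy_covering] along the orbit up to time [M], then let [M]
   tend to infinity. *)
have cover N M : ((M%:R * lam)%:E * P (E N) <= (M + N)%:R%:E * \int[P]_x f x)%E.
  pose b x k := (lam%:E * (\1_(E N) (iter k F x))%:E)%E.
  have mb k : measurable_fun setT (b ^~ k).
    apply: emeasurable_funM => //; apply/measurable_EFinP.
    apply: measurableT_comp => //; exact: measurable_iter.
  have b0 k x : (0 <= b x k)%E by rewrite mule_ge0// lee_fin.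
  have -> : ((M%:R * lam)%:E * P (E N) = \int[P]_x \sum_(i < M) b x i)%E.
    rewrite ge0_integral_sum//.
    have intb k : (\int[P]_x b x k = lam%:E * P (E N))%E.
      rewrite ge0_integralZl//; last first.
        apply/measurable_EFinP; apply: measurableT_comp => //; exact: measurable_iter.
      rewrite (_ : (fun x => _) = EFin \o \1_(iter k F @^-1` E N))//.
      have mEk : measurable (iter k F @^-1` E N).
        by rewrite -[X in measurable X]setTI; apply: measurable_iter.
      rewrite integral_indic// setIT; congr (_ * _)%E; exact: iter_preserves.
    under eq_bigr do rewrite intb.
    elim: M => [|M IH]; first by rewrite big_ord0 mul0r mul0e.
    rewrite big_ord_recr /= -IH -[in LHS]addn1 natrD mulrDl mul1r EFinD ge0_muleDl//.
    by rewrite lee_fin mulr_ge0.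
  rewrite -integral_birkhoff_sum; apply: ge0_le_integral => //.
  - by move=> x _; exact: sume_ge0.
  - exact: emeasurable_sum.
  - exact: measurable_birkhoff_sum.
  move=> x _; apply: (@greedy_covering _ (fun k => f (iter k F x)) (b x) lam N
    lam0 _ _ M 0) => //.
  (* A visit to [E N] at time [k] supplies a block starting at [k], of length at most [N], with
     average at least [lam]. *)
  move=> k; rewrite /b EE; case: ifPn => [|_]; last first.
    by split; [rewrite mule0 lee_fin|left; rewrite mule0].
  rewrite inE mule1 => -[n /andP[n0 nN] nk]; split => //; right; exists n; split => //.
  apply: (le_trans nk); rewrite /birkhoff_sum; apply: lee_sum => i _.
  by rewrite -iterD addnC.
have bound N : (lam%:E * P (E N) <= \int[P]_x f x)%E.
  have : (0 <= \int[P]_x f x)%E by exact: integral_ge0.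
  have := cover N; rewrite -(fineK (fin_num_measure P _ (mE N))).
  case: (\int[P]_x f x)%E => [v| |//] covN; last by move=> _; rewrite leey.
  rewrite -EFinM !lee_fin => v0; rewrite leNgt; apply/negP => vlt.
  set u := fine _ in covN vlt.
  (* If [v < lam * u], then [cover] gives [M * (lam * u - v) <= N * v], which fails for [M] beyond
     this quotient. *)
  have := archi_boundP (_ : 0 <= N%:R * v / (lam * u - v)).
  rewrite divr_ge0 ?mulr_ge0// ?subr_ge0 ?ltW// => /(_ isT).
  set M := Num.bound _; rewrite ltr_pdivrMr ?subr_gt0// => MN.
  have := covN M; rewrite -!EFinM lee_fin natrD leNgt => /negP; apply.
  by rewrite mulrDl -mulrA -ltrBrDl -mulrBr.
have : (lam%:E * (P \o E) n)%E @[n --> \oo] --> (lam%:E * P (birkhoff_exceeds lam))%E.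
  apply: cvgeZl => //; rewrite EU; apply: nondecreasing_cvg_mu => //.
    exact: bigcup_measurable.
  move=> m n mn; apply/subsetPset => x [k /andP[k0 km] xk].
  by exists k => //=; rewrite k0 (leq_trans km).
move=> cvgE; rewrite -(cvg_lim _ cvgE)//; apply: lime_le; last exact: nearW.
by apply/cvg_ex; eexists; exact: cvgE.
Qed.

End MaximalInequality.

(** The maximal inequality bounds [m * P B] by the finite integral of [f] for every [m]. Off this
    set, the averages of [f] along an orbit have a finite bound. *)
Lemma birkhoff_unbounded_null d (T : measurableType d) (R : realType)
    (P : probability T R) (F : T -> T) (f : T -> \bar R) :
  measurable_fun [set: T] F ->
  (forall A, measurable A -> P (F @^-1` A) = P A) ->
  measurable_fun [set: T] f -> (forall x, (0 <= f x)%E) ->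
  (\int[P]_x f x < +oo)%E ->
  P (\bigcap_m birkhoff_exceeds F f m%:R) = 0%E.
Proof.
move=> mF PF mf f0 foo; set B := \bigcap_m _.
have mE m : measurable (birkhoff_exceeds F f m%:R).
  exact: measurable_birkhoff_exceeds.
have mB : measurable B by exact: bigcap_measurable.
have PB m : (m%:R%:E * P B <= \int[P]_x f x)%E.
  apply: (le_trans _ (maximal_inequality mF PF mf f0 (ler0n _ m))).
  apply: lee_wpmul2l; first by rewrite lee_fin.
  by apply: le_measure; rewrite ?inE//; exact: bigcap_inf.
have v0 : (0 <= \int[P]_x f x)%E by exact: integral_ge0.
have Bfin := fin_num_measure P _ mB.
apply/eqP; rewrite eq_le measure_ge0 andbT leNgt; apply/negP.
rewrite -(fineK Bfin) lte_fin => p0.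
move: PB v0 foo; rewrite -(fineK Bfin).
case: (\int[P]_x f x)%E => [v| |]// PB; rewrite lee_fin => v0 _.
have := archi_boundP (divr_ge0 v0 (ltW p0)); rewrite ltr_pdivrMr//.
by rewrite ltNge => /negP; apply; rewrite -lee_fin EFinM.
Qed.

(** The maximal inequality for the indicator of [A m] gives [P B <= 2 * P (A m)], and the right side
    tends to 0. Off this set, for some [m], every nonempty initial orbit segment spends less than
    half of its time in [A m]. *)
Lemma birkhoff_frequent_null d (T : measurableType d) (R : realType)
    (P : probability T R) (F : T -> T) (A : nat -> set T) :
  measurable_fun [set: T] F ->
  (forall A, measurable A -> P (F @^-1` A) = P A) ->
  (forall m, measurable (A m)) -> {homo A : m n / (m <= n)%N >-> n `<=` m} ->
  \bigcap_m A m = set0 ->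
  P (\bigcap_m birkhoff_exceeds F (fun x => (\1_(A m) x)%:E : \bar R) 2^-1) = 0%E.
Proof.
move=> mF PF mA decA A0; set B := \bigcap_m _.
have mf m : measurable_fun [set: T] (fun x => (\1_(A m) x)%:E : \bar R).
  by apply/measurable_EFinP; exact: measurable_indic.
have mE m : measurable (birkhoff_exceeds F (fun x => (\1_(A m) x)%:E : \bar R) 2^-1).
  exact: measurable_birkhoff_exceeds.
have mB : measurable B by exact: bigcap_measurable.
have PB m : ((2^-1)%:E * P B <= P (A m))%E.
  rewrite -[A m]setIT -integral_indic//.
  have f0 x : (0 <= (\1_(A m) x)%:E :> \bar R)%E by rewrite lee_fin.
  have half0 : 0 <= 2^-1 :> R by rewrite invr_ge0.
  apply: (le_trans _ (maximal_inequality mF PF (mf m) f0 half0)).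
  apply: lee_wpmul2l; first by rewrite lee_fin.
  by apply: le_measure; rewrite ?inE//; exact: bigcap_inf.
have PA0 : (P \o A) n @[n --> \oo] --> 0%E.
  rewrite -(measure0 P) -A0; apply: nonincreasing_cvg_mu => //.
  - exact: le_lt_trans (probability_le1 P (mA 0)) (ltry 1).
  - exact: bigcap_measurable.
  - by move=> m n mn; apply/subsetPset/decA.
have : ((2^-1)%:E * P B <= 0)%E.
  rewrite -(cvg_lim _ PA0)//; apply: lime_ge; last exact: nearW.
  by apply/cvg_ex; eexists; exact: PA0.
rewrite pmule_rle0// => PB0.
by apply/eqP; rewrite eq_le PB0 measure_ge0.
Qed.

(** * Hitting times of the flow and visits to the section *)

Section FlowTimes.
Context (R : realType) (X : pointedMetricType R) (Phi : R -> X -> X) (Sigma : set X).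
Hypothesis Phi0 : forall x, Phi 0 x = x.
Hypothesis PhiD : forall s t x, Phi (s + t) x = Phi s (Phi t x).

Local Notation rt := (return_time Phi Sigma).
Local Notation F := (poincare_map Phi Sigma).

Lemma hitting_time_ge0 A x : (0 <= hitting_time Phi A x)%E.
Proof. by apply: le_ereal_inf_tmp => _ [t [t0 _] <-]; rewrite lee_fin ltW. Qed.

Lemma hitting_time_le A x t : 0 < t -> A (Phi t x) -> (hitting_time Phi A x <= t%:E)%E.
Proof. by move=> t0 At; apply: ereal_inf_lbound; exists t. Qed.

Lemma entry_time_in A x : A x -> entry_time Phi A x = 0%E.
Proof.
move=> Ax; apply/eqP; rewrite eq_le; apply/andP; split.
  by apply: ereal_inf_lbound; exists 0; rewrite //= Phi0.
by apply: le_ereal_inf_tmp => _ [t [t0 _] <-]; rewrite lee_fin.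
Qed.

Lemma entry_time_out A x : ~ A x -> entry_time Phi A x = hitting_time Phi A x.
Proof.
move=> nAx; rewrite /entry_time /hitting_time; congr ereal_inf; congr (_ @` _).
apply/seteqP; split => t [t0 At]; split => //; last exact: ltW.
by rewrite lt_neqAle t0 andbT; apply/eqP => t0'; apply: nAx; rewrite -(Phi0 x) t0'.
Qed.

(** As [s] lies strictly before the hitting time, every hit from [x] comes after [s], and the hits
    from [Phi s x] are the same ones shifted by [s]. The value [+oo] is included. *)
Lemma hitting_time_flow A x s : 0 <= s -> (s%:E < hitting_time Phi A x)%E ->
  hitting_time Phi A (Phi s x) = (hitting_time Phi A x - s%:E)%E.
Proof.
move=> s0 sA; apply/eqP; rewrite eq_le; apply/andP; split.
  rewrite leeBrDr//; apply: le_ereal_inf_tmp => _ [t [t0 At] <-].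
  have st : s < t by rewrite -lte_fin (lt_le_trans sA)// hitting_time_le.
  rewrite -leeBrDr// -EFinB; apply: hitting_time_le; first by rewrite subr_gt0.
  by rewrite -PhiD subrK.
apply: le_ereal_inf_tmp => _ [t [t0 At] <-].
by rewrite leeBlDr// -EFinD; apply: hitting_time_le; [exact: ltr_pwDl|rewrite PhiD].
Qed.

(* Over a forward orbit in Sigma all of whose return times are positive and
   finite, [poincare_map] involves no junk value of [fine]. *)
Definition recurrent (y : X) := forall n,
  [/\ Sigma (iter n F y), (0 < rt (iter n F y))%E & (rt (iter n F y) < +oo)%E].

Definition visit_time (n : nat) (y : X) : R := \sum_(i < n) fine (rt (iter i F y)).

Lemma iter_poincare_map n y : iter n F y = Phi (visit_time n y) y.
Proof.
elim: n => [|n IH]; first by rewrite /visit_time big_ord0 Phi0.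
rewrite /visit_time big_ord_recr /= addrC PhiD -/(visit_time n y) -IH.
by [].
Qed.

(** Let [m.+1] be the first index whose visit comes after [t]; it exists because visit times are
    unbounded, and it is not 0 because the visit of index 0 is at time 0. If [t] came strictly after
    visit [m], it would be a return earlier than the return time. *)
Lemma visit_time_exhaust y t : recurrent y ->
  (forall K, exists n, K < visit_time n y) -> 0 <= t -> Sigma (Phi t y) ->
  exists n, t = visit_time n y.
Proof.
move=> recy unb t0 St; have [] := ex_minnP (unb t) => -[|m].
  by rewrite /visit_time big_ord0 ltNge t0.
move=> tm minm; exists m.
have mt : visit_time m y <= t.
  by rewrite leNgt; apply/negP => /minm; rewrite ltnn.
apply/eqP; rewrite eq_le mt andbT leNgt; apply/negP => mt'.
have [_ r0 roo] := recy m.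
have : (rt (iter m F y) <= (t - visit_time m y)%:E)%E.
  apply: hitting_time_le; first by rewrite subr_gt0.
  by rewrite iter_poincare_map -PhiD subrK.
apply/negP; rewrite -ltNge -(@fineK _ (rt _)) ?gt0_fin_numE// lte_fin.
by rewrite ltrBlDl; move: tm; rewrite /visit_time big_ord_recr.
Qed.

(** Both bounds compare the infima element by element, so infinite hitting times need no separate
    case. The constant [s + b] absorbs the delay [s] because the visit index [n] is at least 1. *)
Lemma hitting_time_comparable x y (s a b : R) (A : set X) :
  0 <= s -> (forall t, 0 <= t < s -> ~ Sigma (Phi t x)) -> y = Phi s x ->
  recurrent y -> 0 < a ->
  (forall n, a * n%:R <= visit_time n y <= b * n%:R) ->
  A `<=` Sigma -> ~ A y ->
  [/\ (1 <= poincare_hitting_time Phi Sigma y A)%E,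
      (a%:E * poincare_hitting_time Phi Sigma y A <= hitting_time Phi A x)%E
    & (hitting_time Phi A x <=
       (s + b)%:E * poincare_hitting_time Phi Sigma y A)%E].
Proof.
move=> s0 nS yE recy a0 ab AS nAy.
have b0 : 0 < b.
  have /andP[ha hb] := ab 1%N.
  by rewrite (lt_le_trans a0)// -[leRHS]mulr1 -[a]mulr1 (le_trans ha).
split.
- by apply: le_ereal_inf_tmp => _ [n [n0 _] <-]; rewrite lee_fin ler1n.
- apply: le_ereal_inf_tmp => _ [t [t0 At] <-].
  have st : s <= t.
    by rewrite leNgt; apply/negP => ts; apply: (nS t); [rewrite ltW|exact: AS].
  have Ats : A (Phi (t - s) y) by rewrite yE -PhiD subrK.
  (* The linear lower bound with [a > 0] keeps visits from accumulating at a finite time. *)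
  have unb K : exists n, K < visit_time n y.
    exists (Num.bound (`|K| / a)); have /andP[+ _] := ab (Num.bound (`|K| / a)).
    apply: lt_le_trans; rewrite mulrC -ltr_pdivrMr//.
    apply: le_lt_trans (archi_boundP _); last by rewrite divr_ge0// ltW.
    by rewrite ler_pM2r ?invr_gt0// ler_norm.
  have ts0 : 0 <= t - s by rewrite subr_ge0.
  have [n tn] := visit_time_exhaust recy unb ts0 (AS _ Ats).
  have n0 : (0 < n)%N.
    rewrite lt0n; apply/negP => /eqP n0; apply: nAy.
    by move: Ats; rewrite tn n0 /visit_time big_ord0 Phi0.
  apply: (@le_trans _ _ (a%:E * n%:R%:E)%E).
    apply: lee_wpmul2l; first by rewrite lee_fin ltW.
    by apply: ereal_inf_lbound; exists n; rewrite //= iter_poincare_map -tn.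
  rewrite -EFinM lee_fin; have /andP[+ _] := ab n => /le_trans; apply.
  by rewrite -tn gerBl.
- have sb0 : 0 < s + b by exact: ltr_wpDl.
  rewrite -ereal_inf_pZl//; apply: le_ereal_inf_tmp => _ [_ [n [n0 An] <-] <-].
  have /andP[ha hb] := ab n.
  have n1 : 1 <= n%:R :> R by rewrite ler1n.
  have v0 : 0 < visit_time n y by rewrite (lt_le_trans _ ha)// mulr_gt0// ltr0n.
  apply: (@le_trans _ _ (visit_time n y + s)%:E).
    apply: hitting_time_le; first exact: ltr_pwDl.
    by rewrite PhiD -yE -iter_poincare_map.
  by rewrite -EFinM lee_fin mulrDl addrC lerD// ler_peMr.
Qed.

(** The union is the preimage of [B] under the projection: the projection is the identity on [Sigma]
    and agrees with [F] off it, where entry and return times coincide. In this form its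
    measurability follows from that of [F]. *)
Lemma section_projP (B : set X) x : B `<=` Sigma ->
  (B `|` (~` Sigma `&` F @^-1` B)) x ->
  B (section_proj Phi Sigma x) /\
  exists s, [/\ 0 <= s, forall t, 0 <= t < s -> ~ Sigma (Phi t x)
    & section_proj Phi Sigma x = Phi s x].
Proof.
move=> BS; rewrite /section_proj => -[Bx|[nSx Fx]].
  rewrite /projection_time entry_time_in; last exact: BS.
  by rewrite Phi0; split => //; exists 0; split => // t /andP[t0]; rewrite ltNge t0.
rewrite /projection_time (entry_time_out nSx); split; first exact: Fx.
exists (fine (hitting_time Phi Sigma x)); split => //.
  by apply: fine_ge0; exact: hitting_time_ge0.
move=> t /andP[t0 ts] St.
have t0' : 0 < t.
  by rewrite lt_neqAle t0 andbT; apply/eqP => tE; apply: nSx; rewrite -(Phi0 x) tE.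
have rtt := hitting_time_le t0' St.
move: ts; rewrite -lte_fin fineK; first by rewrite ltNge rtt.
by rewrite ge0_fin_numE ?hitting_time_ge0// (le_lt_trans rtt)// ltry.
Qed.

(** Before its next return, the orbit of [y] meets [Sigma] only at time 0, and every later point of
    the segment has the same image [F y] in [B]. This feeds the integral formula for [mu]. *)
Lemma orbit_segment_in (B : set X) y s : B `<=` Sigma -> B `<=` F @^-1` B ->
  B y -> (rt y < +oo)%E -> 0 <= s -> (s%:E < rt y)%E ->
  (B `|` (~` Sigma `&` F @^-1` B)) (Phi s y).
Proof.
move=> BS BF By yoo s0 sy; have [Ss|nSs] := pselect (Sigma (Phi s y)); [left|right].
  have [s0'|] := ltP 0 s; first by move: sy; rewrite ltNge hitting_time_le.
  by move=> s0'; rewrite (_ : s = 0) ?Phi0//; apply/eqP; rewrite eq_le s0' s0.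
split => //=; rewrite /poincare_map /return_time hitting_time_flow//.
rewrite fineB//; last by rewrite ge0_fin_numE ?hitting_time_ge0.
by rewrite -PhiD subrK; exact: BF.
Qed.

End FlowTimes.

(** * Limits of logarithmic ratios, and almost-everywhere tools *)

Lemma cvge_perturb (R : realType) (T : Type) (G : set_system T) {FG : Filter G}
    (f g : T -> \bar R) (c : T -> R) (l : \bar R) :
  c @ G --> (0 : R) ->
  (\forall x \near G, (g x - (c x)%:E <= f x <= g x + (c x)%:E)%E) ->
  g @ G --> l -> f @ G --> l.
Proof.
move=> c0 gfg gl.
have cE : (fun x => (c x)%:E) @ G --> 0%:E by exact: (@cvg_comp _ _ _ c EFin _ _ _ c0).
apply: (squeeze_cvge gfg).
- rewrite -[l]adde0 -oppe0; apply: cvgeD => //; first exact: fin_num_adde_defl.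
  exact: cvgeN.
- by rewrite -[l]adde0; apply: cvgeD => //; exact: fin_num_adde_defl.
Qed.

(** The logarithms differ by at most [K], and [K / w] tends to 0. Since [u] and [v] may be infinite,
    this is stated as a two-sided bound and not through a difference of the two ratios; [1 <= v]
    keeps both logarithms away from nonpositive arguments. *)
Lemma lne_ratio_cvg (R : realType) (T : Type) (G : set_system T) {FG : Filter G}
    (u v : T -> \bar R) (w : T -> R) (a b : R) (l : \bar R) :
  0 < a -> 0 < b -> w @ G --> +oo ->
  (\forall x \near G, [/\ (1 <= v x)%E, (a%:E * v x <= u x)%E &
     (u x <= b%:E * v x)%E]) ->
  ((lne (u x) / (w x)%:E)%E @[x --> G] --> l) <->
  ((lne (v x) / (w x)%:E)%E @[x --> G] --> l).
Proof.
move=> a0 b0 wy uv; pose K := `|ln a| + `|ln b|.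
have w0 : \forall x \near G, 0 < w x by move/cvgryPgt : wy; apply.
have c0 : (fun x => K / w x) @ G --> (0 : R).
  rewrite -[X in _ --> X](mulr0 K); apply: cvgM; first exact: cvg_cst.
  exact/(gtr0_cvgV0 w0).
have uvK : \forall x \near G,
    (lne (v x) / (w x)%:E - (K / w x)%:E <= lne (u x) / (w x)%:E <=
     lne (v x) / (w x)%:E + (K / w x)%:E)%E.
  near=> x.
  have wx : 0 < w x by near: x.
  have [v1 av ub] : [/\ (1 <= v x)%E, (a%:E * v x <= u x)%E &
     (u x <= b%:E * v x)%E] by near: x.
  have v0 : (0 < v x)%E by exact: lt_le_trans v1.
  have lnM c : 0 < c -> lne (c%:E * v x)%E = (lne (v x) + (ln c)%:E)%E.
    move=> c0'; rewrite addeC -lne_EFin//.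
    by apply: lneM; rewrite in_itv /= leey ?lte_fin ?c0' ?v0.
  have av0 : (0 < a%:E * v x)%E by rewrite mule_gt0.
  have u0 : (0 < u x)%E by exact: lt_le_trans av.
  have iw : (w x)%:E^-1%E = (w x)^-1%:E by rewrite inver gt_eqF.
  have dist c : ((lne (v x) + c%:E) / (w x)%:E = lne (v x) / (w x)%:E + (c / w x)%:E)%E.
    by rewrite iw muleDl// fin_num_adde_defl.
  have w1 : (0 <= (w x)%:E^-1)%E by rewrite iw lee_fin invr_ge0 ltW.
  rewrite -EFinN -mulNr -!dist; apply/andP; split; apply: lee_wpmul2r => //.
  - apply: (@le_trans _ _ (lne (a%:E * v x)%E)).
      rewrite lnM// leeD2l// lee_fin lerNl (le_trans (ler_norm _))// normrN.
      by rewrite lerDl.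
    by rewrite lee_lne// in_itv /= leey ltW.
  - apply: (@le_trans _ _ (lne (b%:E * v x)%E)).
      by rewrite lee_lne// in_itv /= leey ltW// mule_gt0.
    by rewrite lnM// leeD2l// lee_fin (le_trans (ler_norm _))// lerDr.
(* A single [K] serves both directions, as moving the finite error across the inequalities exchanges
   [u] and [v]. *)
split; apply: cvge_perturb c0 _ => //.
apply: filterS uvK => x /andP[h1 h2].
by rewrite leeBlDr// h2 -leeBlDr// h1.
Unshelve. all: by end_near. Qed.

(* No measurability is required of [f]: every simple function below it
   vanishes almost everywhere. *)
Lemma integral_null_support d (T : measurableType d) (R : realType)
    (m : {measure set T -> \bar R}) (D N : set T) (f : T -> \bar R) :
  (forall x, (0 <= f x)%E) -> measurable N -> m N = 0%E ->
  (forall x, D x -> ~ N x -> f x = 0%E) -> (\int[m]_(x in D) f x = 0)%E.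
Proof.
move=> f0 mN N0 fN; apply/eqP; rewrite eq_le integral_ge0// andbT.
rewrite integral_mkcond ge0_integralTE; last exact: erestrict_ge0.
apply: ge_ereal_sup => _ [h hf <-]; rewrite -integralT_nnsfun.
rewrite (ae_eq_integral (cst 0%E))//.
- by rewrite integral0.
- by apply/measurable_EFinP; exact: measurable_funPT.
exists N; split => // x /= /not_implyP[_ hx].
apply: contrapT => Nx; apply: hx.
apply: le_anti; apply/andP; split; last by rewrite lee_fin.
by apply: le_trans (hf x) _; rewrite patchE; case: ifPn => // /set_mem Dx; rewrite fN.
Qed.

(** The intersection of all the preimages of [G] under iterates is a countable intersection of sets
    of full measure. It turns an almost-everywhere property into one that holds along whole forward
    orbits. *)
Lemma invariant_core d (T : measurableType d) (R : realType)
    (P : probability T R) (F : T -> T) (G : set T) :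
  measurable_fun [set: T] F ->
  (forall A, measurable A -> P (F @^-1` A) = P A) ->
  measurable G -> P (~` G) = 0%E ->
  exists B, [/\ measurable B, P (~` B) = 0%E, B `<=` F @^-1` B
    & forall y, B y -> forall n, G (iter n F y)].
Proof.
move=> mF PF mG G0.
have mGn n : measurable (iter n F @^-1` G).
  by rewrite -[X in measurable X]setTI; exact: measurable_iter.
exists (\bigcap_n (iter n F @^-1` G)); split.
- exact: bigcap_measurable.
- rewrite setC_bigcap; apply/negligibleP.
    by apply: bigcup_measurable => n _; exact: measurableC.
  apply: negligible_bigcup => n; apply/negligibleP; first exact: measurableC.
  exact: etrans (iter_preserves mF PF n (measurableC mG)) G0.
- by move=> y By n _ /=; rewrite -iterSr; exact: By n.+1 I.
- by move=> y By n; exact: By n I.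
Qed.

(** * Linear bounds on visit times *)

Section VisitTimeBounds.
Context (R : realType) (X : pointedMetricType R) (Phi : R -> X -> X) (Sigma : set X).

Local Notation rt := (return_time Phi Sigma).
Local Notation F := (poincare_map Phi Sigma : borel X -> borel X).

(** Requiring a positive return time makes the intersection over [m] empty: a point with return time
    0 would otherwise belong to every set. *)
Definition short_return (m : nat) : set (borel X) :=
  [set y | (0 < rt y)%E /\ (rt y < m.+1%:R^-1%:E)%E].

Lemma short_return_nonincreasing :
  {homo short_return : m n / (m <= n)%N >-> n `<=` m}.
Proof.
move=> m n mn y [y0 yn]; split => //; apply: (lt_le_trans yn).
by rewrite lee_fin lef_pV2 ?posrE ?ltr0n// ler_nat.
Qed.

Lemma short_return_cap : \bigcap_m short_return m = set0.
Proof.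
apply/seteqP; split => // y Ay.
have [y0 y1] := Ay 0%N I.
have yfin : rt y \is a fin_num by rewrite gt0_fin_numE// (lt_trans y1)// ltry.
have p0 : 0 < fine (rt y) by rewrite -lte_fin fineK.
have ip0 : 0 <= (fine (rt y))^-1 by rewrite invr_ge0 ltW.
have [_] := Ay (Num.bound (fine (rt y))^-1) I.
rewrite -[X in (X < _)%E]fineK// lte_fin; apply/negP; rewrite -leNgt.
rewrite invf_ple ?posrE ?ltr0n//; apply: ltW.
by rewrite (lt_trans (archi_boundP ip0))// ltr_nat.
Qed.

(** The return time is restricted to [Sigma] because it is integrable only there by assumption; a
    recurrent orbit never leaves [Sigma], so the Birkhoff sums are still the visit times. *)
Lemma visit_time_le y : recurrent Phi Sigma y ->
  ~ (\bigcap_m birkhoff_exceeds F (rt \_ Sigma) m%:R) y ->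
  exists b : R, forall n, visit_time Phi Sigma n y <= b * n%:R.
Proof.
move=> recy nE.
have [m mE] : exists m, ~ birkhoff_exceeds F (rt \_ Sigma) m%:R y.
  by apply/not_existsP => E; apply: nE => m _; apply: contrapT.
exists m%:R => -[|n]; first by rewrite /visit_time big_ord0 mulr0.
rewrite leNgt; apply/negP => nm; apply: mE; exists n.+1 => //=.
have -> : birkhoff_sum F (rt \_ Sigma) n.+1 y = (visit_time Phi Sigma n.+1 y)%:E.
  rewrite /birkhoff_sum /visit_time -sumEFin; apply: eq_bigr => i _.
  have [Si r0 roo] := recy i.
  by rewrite patchE mem_set// fineK// gt0_fin_numE.
by rewrite lee_fin mulrC ltW.
Qed.

(** For some [m], at most half of the first [n] returns are shorter than [1 / m.+1]. The others last
    at least that long each, whence [a = 1 / (2 * m.+1)]. *)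
Lemma visit_time_ge y : recurrent Phi Sigma y ->
  ~ (\bigcap_m birkhoff_exceeds F
       (fun x => (\1_(short_return m) x)%:E : \bar R) 2^-1) y ->
  exists2 a : R, 0 < a & forall n, a * n%:R <= visit_time Phi Sigma n y.
Proof.
move=> recy nE.
have [m mE] : exists m, ~ birkhoff_exceeds F
    (fun x => (\1_(short_return m) x)%:E : \bar R) 2^-1 y.
  by apply/not_existsP => E; apply: nE => m _; apply: contrapT.
have m0 : 0 < m.+1%:R^-1 :> R by rewrite invr_gt0 ltr0n.
exists (m.+1%:R^-1 * 2^-1) => [|[|n]].
- by rewrite mulr_gt0// invr_gt0.
- by rewrite /visit_time big_ord0 mulr0.
have half : \sum_(i < n.+1) \1_(short_return m) (iter i F y) <= n.+1%:R * 2^-1 :> R.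
  rewrite leNgt; apply/negP => h; apply: mE; exists n.+1 => //=.
  by rewrite /birkhoff_sum sumEFin lee_fin ltW.
apply: (@le_trans _ _ (\sum_(i < n.+1) m.+1%:R^-1 *
    (1 - \1_(short_return m) (iter i F y)))).
  rewrite -mulr_sumr -mulrA ler_pM2l// sumrB sumr_const card_ord.
  rewrite lerBrDr (le_trans (lerD (lexx _) half))//.
  by rewrite mulrC -splitr.
apply: ler_sum => i _; have [_ r0 roo] := recy i.
rewrite indicE; case: (boolP (_ \in _)) => [_|].
  by rewrite subrr mulr0 fine_ge0// ltW.
rewrite notin_setE => nsr; rewrite subr0 mulr1 -lee_fin fineK ?gt0_fin_numE//.
by rewrite leNgt; apply/negP => rm; apply: nsr.
Qed.

End VisitTimeBounds.

(** * Good points of the section *)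

Lemma measurable_poincare_map (R : realType) (X : pointedMetricType R)
    (Phi : R -> X -> X) (Sigma : set X) :
  is_flow Phi ->
  measurable_fun [set: borel X] (return_time Phi Sigma : borel X -> \bar R) ->
  measurable_fun [set: borel X] (poincare_map Phi Sigma : borel X -> borel X).
Proof.
move=> [_ _ mPhi] mrt.
(* Joint measurability of the flow enters here: the time itself depends on the point. *)
apply: (@measurableT_comp _ _ _ _ _ _ _ _ (fun x : borel X =>
  (fine (return_time Phi Sigma x) : measurableTypeR R, x)) mPhi).
by apply: measurable_fun_pair => //; exact: measurableT_comp.
Qed.

(** [N] is a null set to be avoided, later [S 0]. The set [B] is the invariant core of the points of
    [Sigma] with positive finite return time that lie outside [N] and the two exceptional Birkhoff
    sets. *)
Lemma recurrent_full_set (R : realType) (X : pointedMetricType R)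
    (Phi : R -> X -> X) (Sigma : set X) (muF : probability (borel X) R)
    (N : set (borel X)) :
  is_flow Phi -> measurable (Sigma : set (borel X)) ->
  measurable_fun [set: borel X] (return_time Phi Sigma : borel X -> \bar R) ->
  muF (~` Sigma) = 0%E -> {ae muF, forall x : borel X, returns Phi Sigma x} ->
  (forall A : set (borel X), measurable A ->
     muF (poincare_map Phi Sigma @^-1` A) = muF A) ->
  (\int[muF]_(x in Sigma) return_time Phi Sigma x < +oo)%E ->
  measurable N -> muF N = 0%E ->
  exists B : set (borel X), [/\ measurable B, muF (~` B) = 0%E,
    B `<=` poincare_map Phi Sigma @^-1` B &
    forall y, B y -> [/\ recurrent Phi Sigma y, ~ N y &
      exists a b : R, 0 < a /\
        forall n, a * n%:R <= visit_time Phi Sigma n y <= b * n%:R]].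
Proof.
move=> flowPhi mS mrt Sc0 aeret PF intt mN N0.
pose F : borel X -> borel X := poincare_map Phi Sigma.
have mF : measurable_fun [set: borel X] F by exact: measurable_poincare_map.
have rt0 x : (0 <= return_time Phi Sigma x)%E by exact: hitting_time_ge0.
pose f : borel X -> \bar R := return_time Phi Sigma \_ Sigma.
have mf : measurable_fun [set: borel X] f.
  by apply/(measurable_restrictT _ mS); exact: measurable_funTS.
pose E1 := \bigcap_m birkhoff_exceeds F f m%:R.
have mE1 : measurable E1.
  by apply: bigcap_measurable => // m _; exact: measurable_birkhoff_exceeds.
have E1_0 : muF E1 = 0%E.
  apply: birkhoff_unbounded_null => //; first by move=> x; exact: erestrict_ge0.
  by rewrite -integral_mkcond.
pose E2 := \bigcap_m birkhoff_exceeds F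
  (fun x => (\1_(short_return Phi Sigma m) x)%:E : \bar R) 2^-1.
have mlt c : measurable [set x : borel X | (return_time Phi Sigma x < c)%E].
  by rewrite -[X in measurable X]setTI; exact: emeasurable_fun_infty_o.
have mgt c : measurable [set x : borel X | (c < return_time Phi Sigma x)%E].
  by rewrite -[X in measurable X]setTI; exact: emeasurable_fun_o_infty.
have msr m : measurable (short_return Phi Sigma m).
  exact: (measurableI _ _ (mgt _) (mlt _)).
have mE2 : measurable E2.
  apply: bigcap_measurable => // m _; apply: measurable_birkhoff_exceeds => //.
  by apply/measurable_EFinP; exact: measurable_indic.
have E2_0 : muF E2 = 0%E.
  apply: birkhoff_frequent_null => //; first exact: short_return_nonincreasing.
  exact: short_return_cap.
pose H := [set x : borel X | (0 < return_time Phi Sigma x)%E] `&`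
  [set x | (return_time Phi Sigma x < +oo)%E].
have mH : measurable H by exact: measurableI.
have H0 : muF (~` H) = 0%E.
  apply/negligibleP; first exact: measurableC.
  apply: negligibleS aeret => x nHx [t [t0 _] tx]; apply: nHx.
  by split => /=; rewrite tx ?lte_fin ?ltry.
pose G := ((Sigma : set (borel X)) `&` H) `\` (N `|` (E1 `|` E2)).
have mG : measurable G.
  apply: measurableD; first exact: measurableI.
  by apply: measurableU => //; exact: measurableU.
have G0 : muF (~` G) = 0%E.
  apply/negligibleP; first exact: measurableC.
  rewrite /G setCD setCI; apply: negligibleU; apply: negligibleU.
  - by apply/negligibleP => //; exact: measurableC.
  - by apply/negligibleP => //; exact: measurableC.
  - exact/negligibleP.
  - by apply: negligibleU; exact/negligibleP.
have [B [mB B0 BF BG]] := invariant_core mF PF mG G0.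
exists B; split => // y By.
have recy : recurrent Phi Sigma y by move=> n; have [[Sn [? ?]] _] := BG y By n.
(* Recurrence needs every iterate in [G]; the exceptional sets need only be avoided by [y]
   itself. *)
have [_ nNE] := BG y By 0%N.
have [b yb] := visit_time_le recy (fun e => nNE (or_intror (or_introl e))).
have [a a0 ya] := visit_time_ge recy (fun e => nNE (or_intror (or_intror e))).
split => //; first by move=> Ny; apply: nNE; left.
by exists a, b; split => // n; rewrite ya yb.
Qed.

(** * Transfer from the section to the flow *)

Unset Implicit Arguments.

Theorem proposition2p5 (R : realType) (X : pointedMetricType R)
    (Phi : R -> X -> X) (mu : {measure set (borel X) -> \bar R})
    (Sigma : set X) (muF : probability (borel X) R) (S : R -> set X)
    (flowPhi : is_flow Phi)
    (presPhi : flow_preserves Phi mu)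
    (ergPhi : flow_ergodic Phi mu)
    (secSigma : is_section Phi Sigma mu)
    (indF : is_induced_measure Phi Sigma mu muF)
    (intt : (\int[muF]_(x in Sigma) return_time Phi Sigma x < +oo)%E)
    (Smeas : forall r, 0 <= r -> measurable (S r : set (borel X)))
    (Ssub : forall r, 0 <= r -> S r `<=` Sigma)
    (Smono : forall r r', 0 <= r -> r <= r' -> S r `<=` S r')
    (S0 : S 0 = \bigcap_(r in [set r : R | 0 < r]) S r)
    (Slim : muF (S r) @[r --> (0 : R)^'+] --> 0%E) :
  exists C : set (borel X),
    [/\ measurable C, mu (~` C) = 0%E &
      forall x, C x -> forall l : \bar R,
        ((lne (hitting_time Phi (S r) x) / (- ln r)%:E)%E
           @[r --> (0 : R)^'+] --> l) <->
        ((lne (poincare_hitting_time Phi Sigma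
                 (section_proj Phi Sigma x) (S r)) / (- ln r)%:E)%E
           @[r --> (0 : R)^'+] --> l)].
Proof.
have [mS mrt _] := secSigma; have [Sc0 aeret PF [c c0 muE]] := indF.
have [Phi0 PhiD _] := flowPhi.
have S0null : muF (S 0) = 0%E.
  apply/eqP; rewrite eq_le measure_ge0 andbT -(cvg_lim _ Slim)//.
  apply: lime_ge; first by apply/cvg_ex; eexists; exact: Slim.
  near=> r; apply: le_measure; rewrite ?inE; [exact: Smeas|exact: Smeas|].
  exact: Smono.
have [B [mB B0 BF Bgood]] := recurrent_full_set flowPhi mS mrt Sc0 aeret PF intt
  (Smeas 0 (lexx 0)) S0null.
have BS : B `<=` Sigma by move=> y /Bgood[/(_ 0%N)[]].
pose F : borel X -> borel X := poincare_map Phi Sigma.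
have mF : measurable_fun [set: borel X] F by exact: measurable_poincare_map.
(* The preimage of [B] under the projection. *)
pose C : set (borel X) := B `|` (~` Sigma `&` F @^-1` B).
have mC : measurable C.
  apply: measurableU => //; apply: measurableI; first exact: measurableC.
  by rewrite -[X in measurable X]setTI; exact: mF.
exists C; split => //.
  rewrite muE; last exact: measurableC.
  (* For [y] in [B] the orbit stays in [C] until its next return, so the inner integral of the
     indicator of the complement is 0; all other [y] lie in the [muF]-null complement of [B]. *)
  rewrite (@integral_null_support _ _ _ _ _ (~` B)) ?mule0//; last 2 first.
  - exact: measurableC.
  - move=> y Sy /contrapT By.
    under eq_integral => s.
      rewrite inE => -[s0 sy].
      rewrite indicE memNset; last first.
        move=> /(_ _)[]; apply: (orbit_segment_in Phi0 PhiD BS BF) => //.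
        by have [/(_ 0%N)[]] := Bgood _ By.
      over.
    by rewrite integral0.
  by move=> y; apply: integral_ge0 => s _; rewrite lee_fin.
move=> x Cx l.
have [By [s [s0 nS yE]]] := section_projP Phi0 BS Cx.
have [recy nS0y [a [b [a0 ab]]]] := Bgood _ By.
set y := section_proj Phi Sigma x in By yE recy nS0y ab *.
(* Since [y] avoids [S 0], it avoids some [S r0], and by monotonicity every smaller [S r]. *)
have [r0 r00 nSr0] : exists2 r0, 0 < r0 & ~ S r0 y.
  apply: contrapT => h; apply: nS0y; rewrite S0 => r r0 /=.
  by apply: contrapT => nSr; apply: h; exists r.
(* The case [n = 1] of the linear bounds gives [a <= b]. *)
have b0 : 0 < s + b.
  have /andP[ha hb] := ab 1%N; move: (le_trans ha hb); rewrite !mulr1 => leab.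
  by rewrite ltr_wpDl// (lt_le_trans a0).
apply: (@lne_ratio_cvg _ _ (at_right 0) _ (fun r => hitting_time Phi (S r) x)
  (fun r => poincare_hitting_time Phi Sigma y (S r)) (fun r => - ln r)
  a (s + b) l a0 b0); first by apply/cvgNry; exact: lnNy.
near=> r; apply: (hitting_time_comparable Phi0 PhiD s0 nS yE recy a0 ab).
  exact: Ssub.
by move=> Sr; apply: nSr0; apply: (Smono r r0) Sr => //; near: r; exact: nbhs_right_le.
Unshelve. all: by end_near. Qed.
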